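(* Put $$l(\alpha,\gamma)=\frac{3}{2\alpha^2(1+2\alpha)}\Bigl((1+4\alpha+12\alpha^2+16\alpha^3+9\alpha^4)-(1+2\alpha+3\alpha^2)\sqrt{(1+\alpha)^2(1+2\alpha+9\alpha^2)+\tfrac{4\gamma}{3}\alpha^2(1+2\alpha)}\Bigr).$$ Each Kerr--Newman--de Sitter subextremal solution is determined by a quadruple $(r_-,r_+,\Lambda a^2,\Lambda e^2)$ satisfying $0<r_-<r_+$, $$0\le\Lambda e^2<\frac{3\alpha^2(1+2\alpha)}{(1+2\alpha+3\alpha^2)^2}<\frac14\qquad\text{and}\qquad 0<\Lambda a^2<l(\alpha,\Lambda e^2),\qquad\text{with }\alpha=\frac{r_+}{r_-}.$$ For a choice of parameters on the graph of $l$ (i.e. $\Lambda a^2=l(\alpha,\Lambda e^2)$) we have $r_+=r_c$. The value of $\Lambda$ is given by $$\Lambda=\frac{(3-\Lambda a^2)-3\sqrt{\left(1-\frac{\Lambda a^2}{3}\right)^2-\frac{4(\Lambda a^2+\Lambda e^2)(r_-^2+r_+^2+r_-r_+)}{3r_-r_+}}}{2(r_-^2+r_+^2+r_-r_+)},$$ and the value of $M$ is given by $$M=\frac\Lambda6\left(2r_-r_+r_c+r_-^2r_++r_-^2r_c+r_+^2r_-+r_+^2r_c+r_c^2r_-+r_c^2r_+\right),$$ with $r_c$ given by $$r_c=-\frac{r_-+r_+}{2}+\sqrt{\frac{(r_-+r_+)^2}{4}+\frac{3(a^2+e^2)}{\Lambda r_-r_+}}.$$ Alternative formulas for the mass are $$\sqrt\Lambda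 M=\frac{(1+\alpha)\bigl(\alpha^2(\sqrt\Lambda r_-)^4+3(\Lambda a^2+\Lambda e^2)\bigr)}{6\alpha(\sqrt\Lambda r_-)}=\frac{-(\sqrt\Lambda r_-)^4+(3-\Lambda a^2)(\sqrt\Lambda r_-)^2+3(\Lambda a^2+\Lambda e^2)}{6(\sqrt\Lambda r_-)}.$$
   Context: A Kerr--Newman--de Sitter solution has parameters $\Lambda>0$ (cosmological constant), $M>0$ (mass parameter), $a>0$ (angular momentum parameter), $e\in\mathbb R$ (charge parameter), and $\Delta_r=(r^2+a^2)\left(1-\frac\Lambda3r^2\right)-2Mr+e^2$. It is called subextremal if $\Delta_r$ (a quartic polynomial in $r$) has four distinct real roots $r_n<0<r_-<r_+<r_c$; $r_-$, $r_+$, $r_c$ are the radii of the Cauchy, event and cosmological horizons. *)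

(* Defs.v *)
From Stdlib Require Import Reals.
Open Scope R_scope.

Definition Delta_r (Lam M a e r : R) : R :=
  (r ^ 2 + a ^ 2) * (1 - Lam / 3 * r ^ 2) - 2 * M * r + e ^ 2.

Definition KNdS (Lam M a : R) : Prop := 0 < Lam /\ 0 < M /\ 0 < a.

(* Being of degree 4, [Delta_r] has no roots besides the four listed, so the
   radii are uniquely determined by the solution. *)
Definition subextremal_radii (Lam M a e rm rp rc : R) : Prop :=
  exists rn : R,
    rn < 0 /\ 0 < rm /\ rm < rp /\ rp < rc /\
    Delta_r Lam M a e rn = 0 /\ Delta_r Lam M a e rm = 0 /\
    Delta_r Lam M a e rp = 0 /\ Delta_r Lam M a e rc = 0.

Definition l (alpha gamma : R) : R :=
  3 / (2 * alpha ^ 2 * (1 + 2 * alpha)) *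
  ((1 + 4 * alpha + 12 * alpha ^ 2 + 16 * alpha ^ 3 + 9 * alpha ^ 4)
   - (1 + 2 * alpha + 3 * alpha ^ 2) *
     sqrt ((1 + alpha) ^ 2 * (1 + 2 * alpha + 9 * alpha ^ 2)
           + 4 * gamma / 3 * alpha ^ 2 * (1 + 2 * alpha))).

Definition gamma_max (alpha : R) : R :=
  3 * alpha ^ 2 * (1 + 2 * alpha) / (1 + 2 * alpha + 3 * alpha ^ 2) ^ 2.

(* Below, [A] and [E] are the values of [Lam * a ^ 2] and [Lam * e ^ 2]. *)

Definition admissible (rm rp A E : R) : Prop :=
  0 < rm /\ rm < rp /\
  0 <= E /\ E < gamma_max (rp / rm) /\ gamma_max (rp / rm) < 1 / 4 /\
  0 < A /\ A < l (rp / rm) E.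

Definition Lambda_radicand (rm rp A E : R) : R :=
  (1 - A / 3) ^ 2
  - 4 * (A + E) * (rm ^ 2 + rp ^ 2 + rm * rp) / (3 * rm * rp).

Definition Lambda_of (rm rp A E : R) : R :=
  ((3 - A) - 3 * sqrt (Lambda_radicand rm rp A E))
  / (2 * (rm ^ 2 + rp ^ 2 + rm * rp)).

Definition rc_of (Lam a e rm rp : R) : R :=
  - ((rm + rp) / 2)
  + sqrt ((rm + rp) ^ 2 / 4 + 3 * (a ^ 2 + e ^ 2) / (Lam * rm * rp)).

Definition M_of (Lam rm rp rc : R) : R :=
  Lam / 6 *
  (2 * rm * rp * rc + rm ^ 2 * rp + rm ^ 2 * rc + rp ^ 2 * rm
   + rp ^ 2 * rc + rc ^ 2 * rm + rc ^ 2 * rp).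

(* In both formulas for [sqrt Lam * M], [x] stands for [sqrt Lam * rm]. *)

Definition sqrtLambda_M_1 (alpha x A E : R) : R :=
  (1 + alpha) * (alpha ^ 2 * x ^ 4 + 3 * (A + E)) / (6 * alpha * x).

Definition sqrtLambda_M_2 (x A E : R) : R :=
  (- (x ^ 4) + (3 - A) * x ^ 2 + 3 * (A + E)) / (6 * x).

(* [sqrt] is total and vanishes on negative reals, so the non-negativity of the
   radicand, which the formula for [Lam] presupposes, is stated separately; the
   other radicands are manifestly positive where they are used. *)
Definition value_formulas (Lam M a e rm rp rc : R) : Prop :=
  let A := Lam * a ^ 2 in
  let E := Lam * e ^ 2 in
  0 <= Lambda_radicand rm rp A E /\
  Lam = Lambda_of rm rp A E /\
  M = M_of Lam rm rp rc /\
  rc = rc_of Lam a e rm rp /\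
  sqrt Lam * M = sqrtLambda_M_1 (rp / rm) (sqrt Lam * rm) A E /\
  sqrt Lam * M = sqrtLambda_M_2 (sqrt Lam * rm) A E.

(* Main.v *)
(** Write [s = rm + rp], [p = rm * rp], [q = rm^2 + rp^2 + rm rp].  As
    [Delta_r] has no cubic term, its negative root is [-(s + rc)], and comparing
    the remaining coefficients turns the problem into two equations in [Lam]
    and [C = rc (s + rc)], namely [Lam q + Lam C = 3 - A] and
    [Lam^2 p C = 3 (A + E)].  Hence [Lam q] and [Lam C] are the roots of a
    quadratic, and [rp <= rc] forces [q <= C], which selects the minus sign in
    the formula for [Lam].  In the degenerate case [rc = rp] the first equation
    is linear in [Lam]; eliminating [Lam] expresses [E] as a function
    [charge_bound] of [alpha] and [A], decreasing in [A], whose inverse is [l].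
    In general the sign of [charge_bound alpha A - E] is that of [rc - rp]. *)
Require Import Defs.
From Stdlib Require Import Reals Lra Psatz.
Open Scope R_scope.

(** When [rc = rp], the quotient [(3 - A) / (1 + 2 * alpha + 3 * alpha ^ 2)] is [Lam * rm ^ 2], and
    the prefactor is a third of [rm * rp * C] in units of [rm]. *)
Definition charge_bound (alpha A : R) : R :=
  alpha ^ 2 * (1 + 2 * alpha) / 3 * ((3 - A) / (1 + 2 * alpha + 3 * alpha ^ 2)) ^ 2
  - A.

(** The coefficients of degree 2, 0 and 1, with the fourth root eliminated. Unlike
    [subextremal_radii], this makes sense for a double root [rc = rp]. *)
Definition vieta (Lam M a e rm rp rc : R) : Prop :=
  Lam * (rm ^ 2 + rp ^ 2 + rm * rp + rc * (rm + rp + rc)) = 3 - Lam * a ^ 2 /\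
  Lam * (rm * rp * (rc * (rm + rp + rc))) = 3 * (a ^ 2 + e ^ 2) /\
  M = M_of Lam rm rp rc.

(** * The function [charge_bound] and its inverse [l] *)

Lemma charge_bound_0 (alpha : R) :
  0 < alpha -> charge_bound alpha 0 = gamma_max alpha.
Proof.
  intros Ha; unfold charge_bound, gamma_max; field; nra.
Qed.

Lemma charge_bound_decreasing (alpha A B : R) :
  0 < alpha -> A < B -> B <= 3 -> charge_bound alpha B < charge_bound alpha A.
Proof.
  intros Ha HAB HB; unfold charge_bound.
  set (D := 1 + 2 * alpha + 3 * alpha ^ 2).
  assert (HD : 0 < D) by (unfold D; nra).
  assert (Hk : 0 < alpha ^ 2 * (1 + 2 * alpha) / 3) by nra.
  assert (HB' : 0 <= (3 - B) / D)
    by (apply Rmult_le_pos; [lra | left; apply Rinv_0_lt_compat, HD]).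
  assert (HBA : (3 - B) / D < (3 - A) / D)
    by (apply Rmult_lt_compat_r; [apply Rinv_0_lt_compat, HD | lra]).
  assert (Hsq : ((3 - B) / D) ^ 2 < ((3 - A) / D) ^ 2) by nra.
  pose proof (Rmult_lt_compat_l _ _ _ Hk Hsq).
  lra.
Qed.

Lemma gamma_max_lt_quarter (alpha : R) : 1 < alpha -> gamma_max alpha < 1 / 4.
Proof.
  intros Ha; unfold gamma_max.
  assert (HD : 0 < (1 + 2 * alpha + 3 * alpha ^ 2) ^ 2) by (apply pow_lt; nra).
  (* This square is [(1 + 2 * alpha + 3 * alpha ^ 2) ^ 2 - 12 * alpha ^ 2 * (1 + 2 * alpha)]. *)
  assert (Hsq : 0 < ((alpha - 1) * (3 * alpha + 1)) ^ 2) by (apply pow_lt; nra).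
  apply (Rmult_lt_reg_r _ _ _ HD).
  unfold Rdiv at 1; rewrite Rmult_assoc, Rinv_l by lra.
  nra.
Qed.

(** Keeps [l] in the range where [charge_bound] decreases. In terms of [u], [D] and the root
    [w > D], [l] is [3 - 3 * D * (w - D) / (2 * u)]. *)
Lemma l_lt_3 (alpha gamma : R) : 0 < alpha -> 0 <= gamma -> l alpha gamma < 3.
Proof.
  intros Ha Hg; unfold l.
  set (u := alpha ^ 2 * (1 + 2 * alpha)).
  set (D := 1 + 2 * alpha + 3 * alpha ^ 2).
  assert (Hu : 0 < u) by (unfold u; nra).
  assert (HD : 0 < D) by (unfold D; nra).
  replace ((1 + alpha) ^ 2 * (1 + 2 * alpha + 9 * alpha ^ 2)
           + 4 * gamma / 3 * alpha ^ 2 * (1 + 2 * alpha))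
    with (D ^ 2 + 4 * u * (3 + gamma) / 3) by (unfold D, u; field).
  replace (1 + 4 * alpha + 12 * alpha ^ 2 + 16 * alpha ^ 3 + 9 * alpha ^ 4)
    with (2 * u + D ^ 2) by (unfold D, u; ring).
  set (w := sqrt _).
  assert (Hw : D < w).
  { unfold w; rewrite <- (sqrt_pow2 D) at 1 by lra.
    apply sqrt_lt_1; nra. }
  replace (3 / (2 * alpha ^ 2 * (1 + 2 * alpha)) * (2 * u + D ^ 2 - D * w))
    with (3 - 3 * D * (w - D) / (2 * u)) by (unfold u; field; lra).
  assert (0 < 3 * D * (w - D) / (2 * u)) by (apply Rdiv_lt_0_compat; nra).
  lra.
Qed.

(** [l] is the smaller root of the quadratic equation [charge_bound alpha A = gamma] in [A]. *)
Lemma charge_bound_l (alpha gamma : R) :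
  0 < alpha -> 0 <= gamma -> charge_bound alpha (l alpha gamma) = gamma.
Proof.
  intros Ha Hg; unfold charge_bound, l.
  set (u := alpha ^ 2 * (1 + 2 * alpha)).
  set (D := 1 + 2 * alpha + 3 * alpha ^ 2).
  assert (Hu : 0 < u) by (unfold u; nra).
  assert (HD : 0 < D) by (unfold D; nra).
  replace ((1 + alpha) ^ 2 * (1 + 2 * alpha + 9 * alpha ^ 2)
           + 4 * gamma / 3 * alpha ^ 2 * (1 + 2 * alpha))
    with (D ^ 2 + 4 * u * (3 + gamma) / 3) by (unfold D, u; field).
  replace (1 + 4 * alpha + 12 * alpha ^ 2 + 16 * alpha ^ 3 + 9 * alpha ^ 4)
    with (2 * u + D ^ 2) by (unfold D, u; ring).
  set (w := sqrt _).
  assert (Hw : w ^ 2 = D ^ 2 + 4 * u * (3 + gamma) / 3)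
    by (unfold w; apply pow2_sqrt; nra).
  replace (2 * alpha ^ 2 * (1 + 2 * alpha)) with (2 * u) by (unfold u; ring).
  (* The terms linear in [w] cancel: [(w - D) ^ 2 + 2 * D * (w - D) = w ^ 2 - D ^ 2]. *)
  transitivity (3 / (4 * u) * (w ^ 2 - D ^ 2) - 3).
  - field; lra.
  - rewrite Hw; field; lra.
Qed.

Lemma lt_l_iff (alpha gamma A : R) :
  0 < alpha -> 0 <= gamma -> A <= 3 ->
  A < l alpha gamma <-> gamma < charge_bound alpha A.
Proof.
  intros Ha Hg HA.
  pose proof (charge_bound_l _ _ Ha Hg) as Hl.
  pose proof (l_lt_3 _ _ Ha Hg) as Hl3.
  split; intros H.
  - rewrite <- Hl at 1; apply charge_bound_decreasing; lra.
  - destruct (Rlt_le_dec A (l alpha gamma)) as [|Hle]; [assumption|].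
    destruct Hle as [Hlt|Heq].
    + pose proof (charge_bound_decreasing _ _ _ Ha Hlt HA); lra.
    + rewrite Heq in Hl; lra.
Qed.

(** * Vieta relations and the value formulas *)

Lemma M_of_pos (Lam rm rp rc : R) :
  0 < Lam -> 0 < rm -> 0 < rp -> 0 < rc -> 0 < M_of Lam rm rp rc.
Proof.
  intros HL Hm Hp Hc; unfold M_of.
  pose proof (Rmult_lt_0_compat _ _ Hm Hp) as Hmp.
  pose proof (Rmult_lt_0_compat _ _ Hm Hc) as Hmc.
  pose proof (Rmult_lt_0_compat _ _ Hp Hc) as Hpc.
  apply Rmult_lt_0_compat; [lra | nra].
Qed.

Lemma vieta_factorization (Lam M a e rm rp rc r : R) :
  vieta Lam M a e rm rp rc ->
  Delta_r Lam M a e r =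
  - (Lam / 3) * (r + (rm + rp + rc)) * (r - rm) * (r - rp) * (r - rc).
Proof.
  intros (H1 & H2 & ->); unfold Delta_r, M_of.
  assert (Ha : Lam * a ^ 2 =
    3 - Lam * (rm ^ 2 + rp ^ 2 + rm * rp + rc * (rm + rp + rc))) by lra.
  assert (He : e ^ 2 =
    Lam * (rm * rp * (rc * (rm + rp + rc))) / 3 - a ^ 2) by lra.
  rewrite He.
  replace ((r ^ 2 + a ^ 2) * (1 - Lam / 3 * r ^ 2))
    with (r ^ 2 - Lam / 3 * r ^ 4 + a ^ 2 - Lam * a ^ 2 * r ^ 2 / 3) by field.
  rewrite Ha; field.
Qed.

(* Successive divided differences of [Delta_r] at its roots. *)
Lemma subextremal_vieta (Lam M a e rm rp rc : R) :
  0 < Lam -> subextremal_radii Lam M a e rm rp rc -> vieta Lam M a e rm rp rc.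
Proof.
  intros HL (rn & Hn & Hm & Hmp & Hpc & En & Em & Ep & Ec).
  unfold Delta_r in *.
  pose (d1 := fun u v : R =>
    - (Lam / 3) * (u + v) * (u ^ 2 + v ^ 2) + (1 - Lam * a ^ 2 / 3) * (u + v)
    - 2 * M).
  pose (d2 := fun u v w : R =>
    - (Lam / 3) * (u ^ 2 + v ^ 2 + w ^ 2 + u * v + u * w + v * w)
    + (1 - Lam * a ^ 2 / 3)).
  assert (Hnm : d1 rn rm = 0)
    by (apply (Rmult_eq_reg_l (rn - rm)); [unfold d1; nra | lra]).
  assert (Hmp1 : d1 rm rp = 0)
    by (apply (Rmult_eq_reg_l (rm - rp)); [unfold d1; nra | lra]).
  assert (Hpc1 : d1 rp rc = 0)
    by (apply (Rmult_eq_reg_l (rp - rc)); [unfold d1; nra | lra]).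
  assert (Hnmp : d2 rn rm rp = 0)
    by (apply (Rmult_eq_reg_l (rn - rp)); [unfold d1, d2 in *; nra | lra]).
  assert (Hmpc : d2 rm rp rc = 0)
    by (apply (Rmult_eq_reg_l (rm - rc)); [unfold d1, d2 in *; nra | lra]).
  unfold d1, d2 in *.
  assert (H1 : Lam * (rm ^ 2 + rp ^ 2 + rm * rp + rc * (rm + rp + rc))
               = 3 - Lam * a ^ 2) by lra.
  assert (Ha : Lam * a ^ 2 =
    3 - Lam * (rm ^ 2 + rp ^ 2 + rm * rp + rc * (rm + rp + rc))) by lra.
  rewrite Ha in Hmp1.
  assert (HM : M = M_of Lam rm rp rc) by (unfold M_of; lra).
  split; [exact H1 | split; [| exact HM]].
  replace ((rm ^ 2 + a ^ 2) * (1 - Lam / 3 * rm ^ 2))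
    with (rm ^ 2 - Lam / 3 * rm ^ 4 + a ^ 2 - Lam * a ^ 2 * rm ^ 2 / 3)
    in Em by field.
  rewrite Ha, HM in Em; unfold M_of in Em; lra.
Qed.

Lemma vieta_subextremal (Lam M a e rm rp rc : R) :
  0 < rm -> rm < rp -> rp < rc -> vieta Lam M a e rm rp rc ->
  subextremal_radii Lam M a e rm rp rc.
Proof.
  intros Hm Hmp Hpc HV; exists (- (rm + rp + rc)).
  repeat split; try lra; rewrite (vieta_factorization _ _ _ _ _ _ _ _ HV); ring.
Qed.

Lemma vieta_formulas (Lam M a e rm rp rc : R) :
  0 < Lam -> 0 < rm -> rm < rp -> rp <= rc ->
  vieta Lam M a e rm rp rc -> value_formulas Lam M a e rm rp rc.
Proof.
  intros HL Hm Hmp Hpc (H1 & H2 & HM).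
  set (q := rm ^ 2 + rp ^ 2 + rm * rp) in *.
  set (C := rc * (rm + rp + rc)) in *.
  assert (Hp : 0 < rm * rp) by nra.
  assert (Hq : 0 < q) by (unfold q; nra).
  assert (HqC : q <= C) by (unfold q, C; nra).
  (* The radicand is, up to the factor 9, the discriminant of the quadratic with roots [Lam * q] and
     [Lam * C]. *)
  assert (Hrad : Lambda_radicand rm rp (Lam * a ^ 2) (Lam * e ^ 2)
                 = (Lam * (C - q) / 3) ^ 2).
  { unfold Lambda_radicand; fold q.
    replace (Lam * a ^ 2 + Lam * e ^ 2) with (Lam * (a ^ 2 + e ^ 2)) by ring.
    replace (a ^ 2 + e ^ 2) with (Lam * (rm * rp * C) / 3) by lra.
    replace (1 - Lam * a ^ 2 / 3) with (Lam * (q + C) / 3) by lra.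
    field; lra. }
  set (x := sqrt Lam).
  assert (Hx : 0 < x) by (apply sqrt_lt_R0, HL).
  assert (HxL : Lam = x ^ 2) by (unfold x; symmetry; apply pow2_sqrt; lra).
  assert (HAE : 3 * (Lam * a ^ 2 + Lam * e ^ 2) = Lam * (Lam * (rm * rp * C)))
    by (rewrite H2; ring).
  repeat split.
  - rewrite Hrad; apply pow2_ge_0.
  - unfold Lambda_of; rewrite Hrad, sqrt_pow2 by nra; fold q.
    rewrite <- H1; field; lra.
  - exact HM.
  - unfold rc_of.
    replace ((rm + rp) ^ 2 / 4 + 3 * (a ^ 2 + e ^ 2) / (Lam * rm * rp))
      (* Completing the square in [C = rc * (rm + rp + rc)]. *)
      with ((rc + (rm + rp) / 2) ^ 2).
    + rewrite sqrt_pow2 by lra; ring.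
    + rewrite <- H2; unfold C; field; lra.
  - fold x; unfold sqrtLambda_M_1; rewrite HAE, HM.
    unfold M_of, C; rewrite HxL; field; lra.
  - fold x; unfold sqrtLambda_M_2; rewrite HAE, <- H1, HM.
    unfold M_of, C, q; rewrite HxL; field; lra.
Qed.

(** * From the formulas back to the Vieta relations *)

Lemma Lambda_of_pos (rm rp A E : R) :
  0 < rm -> 0 < rp -> 0 < A + E -> A < 3 -> 0 < Lambda_of rm rp A E.
Proof.
  intros Hm Hp HAE HA; unfold Lambda_of, Lambda_radicand.
  set (q := rm ^ 2 + rp ^ 2 + rm * rp).
  assert (Hp' : 0 < rm * rp) by nra.
  assert (Hq : 0 < q) by (unfold q; nra).
  assert (Hd : 0 < 4 * (A + E) * q / (3 * rm * rp))
    by (apply Rdiv_lt_0_compat; nra).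
  assert (Hs : sqrt ((1 - A / 3) ^ 2 - 4 * (A + E) * q / (3 * rm * rp))
               < 1 - A / 3).
  { rewrite <- (sqrt_pow2 (1 - A / 3)) at 2 by lra.
    (* A negative radicand gives [sqrt] the value 0, which is still below [1 - A / 3]. *)
    destruct (Rle_lt_dec 0 ((1 - A / 3) ^ 2 - 4 * (A + E) * q / (3 * rm * rp))).
    - apply sqrt_lt_1_alt; lra.
    - rewrite sqrt_neg_0, sqrt_pow2 by lra; lra. }
  apply Rdiv_lt_0_compat; lra.
Qed.

(** Assuming [q <= C] instead of an order between [rp] and [rc] lets the sign be read in both
    directions. *)
Lemma charge_bound_sub_eq (Lam M a e rm rp rc : R) :
  0 < Lam -> 0 < rm -> rm < rp -> 0 < rc ->
  rm ^ 2 + rp ^ 2 + rm * rp <= rc * (rm + rp + rc) ->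
  vieta Lam M a e rm rp rc ->
  exists k : R, 0 < k /\
    charge_bound (rp / rm) (Lam * a ^ 2) - Lam * e ^ 2 = k * (rc - rp).
Proof.
  intros HL Hm Hmp Hc HqC (H1 & H2 & _).
  set (q := rm ^ 2 + rp ^ 2 + rm * rp) in *.
  set (C := rc * (rm + rp + rc)) in *.
  (* The value of [C] at [rc = rp]. *)
  set (t := rp * (rm + 2 * rp)).
  assert (Hp : 0 < rm * rp) by nra.
  assert (Hq : 0 < q) by (unfold q; nra).
  assert (Ht : q < t) by (unfold q, t; nra).
  (* From [t * (q + C) ^ 2 - C * (t + q) ^ 2 = (C - t) * (C * t - q ^ 2)] and
     [C - t = (rc - rp) * (rc + 2 * rp + rm)]; positive because [q <= C] and [q < t]. *)
  exists (Lam ^ 2 * (rm * rp) * (rc + 2 * rp + rm) * (C * t - q ^ 2)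
          / (3 * (t + q) ^ 2)).
  split.
  - apply Rdiv_lt_0_compat; [| nra].
    repeat apply Rmult_lt_0_compat; nra.
  - replace (Lam * e ^ 2) with (Lam * (Lam * (rm * rp * C)) / 3 - Lam * a ^ 2)
      by (rewrite H2; field).
    unfold charge_bound; rewrite <- H1.
    replace (1 + 2 * (rp / rm) + 3 * (rp / rm) ^ 2) with ((t + q) / rm ^ 2)
      by (unfold t, q; field; lra).
    assert (HD : rp * (rm + 2 * rp) + (rm ^ 2 + rp ^ 2 + rm * rp) <> 0)
      by (fold t q; lra).
    unfold C, t, q; field; repeat split; lra.
Qed.

(** The radicand is affine in [E] and a perfect square at [E = charge_bound (rp / rm) A]. Hence it
    is nonnegative for all smaller [E]. *)
Lemma Lambda_radicand_eq (rm rp A E : R) :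
  0 < rm -> 0 < rp ->
  Lambda_radicand rm rp A E =
  ((3 - A) * (rp ^ 2 - rm ^ 2) / (3 * (rm ^ 2 + 3 * rp ^ 2 + 2 * rm * rp))) ^ 2
  + 4 * (rm ^ 2 + rp ^ 2 + rm * rp) / (3 * (rm * rp))
    * (charge_bound (rp / rm) A - E).
Proof.
  intros Hm Hp; unfold Lambda_radicand, charge_bound.
  assert (HD : 0 < rm ^ 2 + 3 * rp ^ 2 + 2 * rm * rp) by nra.
  replace (1 + 2 * (rp / rm) + 3 * (rp / rm) ^ 2)
    with ((rm ^ 2 + 3 * rp ^ 2 + 2 * rm * rp) / rm ^ 2) by (field; lra).
  field; repeat split; lra.
Qed.

Lemma formulas_vieta (rm rp A E a e : R) :
  let Lam := Lambda_of rm rp A E in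
  let rc := rc_of Lam a e rm rp in
  0 < rm -> rm < rp -> 0 < A -> A < 3 -> 0 <= E ->
  E <= charge_bound (rp / rm) A ->
  Lam * a ^ 2 = A -> Lam * e ^ 2 = E ->
  0 < rc /\
  rm ^ 2 + rp ^ 2 + rm * rp <= rc * (rm + rp + rc) /\
  vieta Lam (M_of Lam rm rp rc) a e rm rp rc.
Proof.
  intros Lam rc Hm Hmp HA HA3 HE HEb HLa HLe.
  assert (HL : 0 < Lam) by (apply Lambda_of_pos; lra).
  assert (Hp : 0 < rm * rp) by nra.
  set (q := rm ^ 2 + rp ^ 2 + rm * rp).
  assert (Hq : 0 < q) by (unfold q; nra).
  assert (Hrad : 0 <= Lambda_radicand rm rp A E).
  { rewrite Lambda_radicand_eq by lra; fold q.
    apply Rplus_le_le_0_compat; [apply pow2_ge_0 |].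
    apply Rmult_le_pos; [| lra].
    left; apply Rdiv_lt_0_compat; lra. }
  set (w := sqrt (Lambda_radicand rm rp A E)).
  assert (Hw0 : 0 <= w) by apply sqrt_pos.
  assert (Hw : w ^ 2 = (1 - A / 3) ^ 2 - 4 * (A + E) * q / (3 * rm * rp))
    by (apply pow2_sqrt, Hrad).
  assert (HLq : 2 * (Lam * q) = 3 - A - 3 * w)
    by (unfold Lam, Lambda_of; fold q w; field; lra).
  assert (Hae : 0 < 3 * (a ^ 2 + e ^ 2) / (Lam * rm * rp)).
  { apply Rdiv_lt_0_compat; [| rewrite Rmult_assoc; nra].
    apply (Rmult_lt_reg_l Lam); lra. }
  assert (Hrc : (rc + (rm + rp) / 2) ^ 2
                = (rm + rp) ^ 2 / 4 + 3 * (a ^ 2 + e ^ 2) / (Lam * rm * rp)).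
  { unfold rc, rc_of.
    replace (- ((rm + rp) / 2) + sqrt ((rm + rp) ^ 2 / 4
             + 3 * (a ^ 2 + e ^ 2) / (Lam * rm * rp)) + (rm + rp) / 2)
      with (sqrt ((rm + rp) ^ 2 / 4 + 3 * (a ^ 2 + e ^ 2) / (Lam * rm * rp)))
      by ring.
    apply pow2_sqrt; nra. }
  assert (Hrc0 : - ((rm + rp) / 2) <= rc).
  { unfold rc, rc_of.
    pose proof (sqrt_pos ((rm + rp) ^ 2 / 4
                          + 3 * (a ^ 2 + e ^ 2) / (Lam * rm * rp))); lra. }
  set (C := rc * (rm + rp + rc)).
  assert (HC : C = 3 * (a ^ 2 + e ^ 2) / (Lam * rm * rp)) by (unfold C; lra).
  assert (H2 : Lam * (rm * rp * C) = 3 * (a ^ 2 + e ^ 2))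
    by (rewrite HC; field; lra).
  (* [Lam * q] is the smaller root by definition of [Lam]; the known product of the roots makes
     [Lam * C] the larger one. *)
  assert (HLC : 2 * (Lam * C) = 3 - A + 3 * w).
  { apply (Rmult_eq_reg_l (2 * (Lam * q))); [| nra].
    transitivity (4 * q * (3 * (A + E)) / (rm * rp)).
    - rewrite <- HLa, <- HLe.
      replace (3 * (Lam * a ^ 2 + Lam * e ^ 2))
        with (Lam * (Lam * (rm * rp * C))) by (rewrite H2; ring).
      field; lra.
    - rewrite HLq.
      replace ((3 - A - 3 * w) * (3 - A + 3 * w))
        with ((3 - A) ^ 2 - 9 * w ^ 2) by ring.
      rewrite Hw; field; lra. }
  (* [C > 0] together with [rc >= - (rm + rp) / 2] excludes [rc <= 0]. *)
  split; [unfold C in HC; nra |].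
  split; [apply (Rmult_le_reg_l Lam); lra |].
  split; [| split; [exact H2 | reflexivity]].
  rewrite HLa; fold q C; lra.
Qed.

(** * The four claims of the theorem *)

Lemma subextremal_admissible (Lam M a e rm rp rc : R) :
  KNdS Lam M a -> subextremal_radii Lam M a e rm rp rc ->
  admissible rm rp (Lam * a ^ 2) (Lam * e ^ 2) /\
  value_formulas Lam M a e rm rp rc.
Proof.
  intros (HL & HM & Ha) Hsub.
  pose proof (subextremal_vieta _ _ _ _ _ _ _ HL Hsub) as HV.
  destruct Hsub as (rn & _ & Hm & Hmp & Hpc & _).
  split; [| apply vieta_formulas; try assumption; lra].
  assert (Hc : 0 < rc) by lra.
  assert (HqC : rm ^ 2 + rp ^ 2 + rm * rp <= rc * (rm + rp + rc)) by nra.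
  destruct (charge_bound_sub_eq _ _ _ _ _ _ _ HL Hm Hmp Hc HqC HV)
    as (k & Hk & Hbound).
  assert (HE : Lam * e ^ 2 < charge_bound (rp / rm) (Lam * a ^ 2)) by nra.
  assert (HA : 0 < Lam * a ^ 2)
    by (apply Rmult_lt_0_compat; [exact HL | apply pow_lt, Ha]).
  assert (HE0 : 0 <= Lam * e ^ 2) by nra.
  assert (HA3 : Lam * a ^ 2 < 3).
  { destruct HV as (H1 & _).
    assert (0 < Lam * (rm ^ 2 + rp ^ 2 + rm * rp + rc * (rm + rp + rc)))
      by (apply Rmult_lt_0_compat; nra).
    lra. }
  assert (Halpha : 1 < rp / rm)
    by (apply (Rmult_lt_reg_r rm); [lra | field_simplify; lra]).
  repeat split; try assumption.
  (* [E < charge_bound alpha A < charge_bound alpha 0], by monotonicity. *)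
  - rewrite <- charge_bound_0 by lra.
    apply (Rlt_trans _ _ _ HE), charge_bound_decreasing; lra.
  - apply gamma_max_lt_quarter, Halpha.
  - apply lt_l_iff; lra.
Qed.

Lemma subextremal_unique (Lam1 M1 a1 e1 rc1 Lam2 M2 a2 e2 rc2 rm rp : R) :
  KNdS Lam1 M1 a1 -> subextremal_radii Lam1 M1 a1 e1 rm rp rc1 ->
  KNdS Lam2 M2 a2 -> subextremal_radii Lam2 M2 a2 e2 rm rp rc2 ->
  Lam1 * a1 ^ 2 = Lam2 * a2 ^ 2 -> Lam1 * e1 ^ 2 = Lam2 * e2 ^ 2 ->
  Lam1 = Lam2 /\ M1 = M2 /\ a1 = a2 /\ e1 ^ 2 = e2 ^ 2.
Proof.
  intros HK1 Hs1 HK2 Hs2 HA HE.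
  destruct (subextremal_admissible _ _ _ _ _ _ _ HK1 Hs1)
    as (_ & _ & HL1 & HM1 & Hc1 & _).
  destruct (subextremal_admissible _ _ _ _ _ _ _ HK2 Hs2)
    as (_ & _ & HL2 & HM2 & Hc2 & _).
  destruct HK1 as (HL & _ & Ha1), HK2 as (_ & _ & Ha2).
  assert (HLL : Lam1 = Lam2) by (rewrite HL1, HL2, HA, HE; reflexivity).
  clear HL1 HL2; subst Lam2.
  apply Rmult_eq_reg_l in HA; [| lra].
  apply Rmult_eq_reg_l in HE; [| lra].
  assert (Hcc : rc1 = rc2)
    by (rewrite Hc1, Hc2; unfold rc_of; rewrite HA, HE; reflexivity).
  repeat split; [rewrite HM1, HM2, Hcc; reflexivity | nra | exact HE].
Qed.

Lemma admissible_subextremal (rm rp A E : R) :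
  admissible rm rp A E ->
  exists Lam M a e rc : R,
    KNdS Lam M a /\ subextremal_radii Lam M a e rm rp rc /\
    Lam * a ^ 2 = A /\ Lam * e ^ 2 = E.
Proof.
  intros (Hm & Hmp & HE & _ & _ & HA & HAl).
  assert (Halpha : 0 < rp / rm) by (apply Rdiv_lt_0_compat; lra).
  assert (HA3 : A < 3) by (pose proof (l_lt_3 _ _ Halpha HE); lra).
  apply lt_l_iff in HAl; try lra.
  set (Lam := Lambda_of rm rp A E).
  assert (HL : 0 < Lam) by (apply Lambda_of_pos; lra).
  set (a := sqrt (A / Lam)).
  set (e := sqrt (E / Lam)).
  assert (Ha : 0 < a) by (apply sqrt_lt_R0, Rdiv_lt_0_compat; assumption).
  assert (HLa : Lam * a ^ 2 = A).
  { unfold a; rewrite pow2_sqrt; [field; lra |].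
    left; apply Rdiv_lt_0_compat; assumption. }
  assert (HLe : Lam * e ^ 2 = E).
  { unfold e; rewrite pow2_sqrt; [field; lra |].
    apply Rmult_le_pos; [lra | left; apply Rinv_0_lt_compat, HL]. }
  destruct (formulas_vieta rm rp A E a e Hm Hmp HA HA3 HE
              ltac:(lra) HLa HLe) as (Hc & HqC & HV).
  fold Lam in Hc, HqC, HV.
  set (rc := rc_of Lam a e rm rp) in *.
  destruct (charge_bound_sub_eq _ _ _ _ _ _ _ HL Hm Hmp Hc HqC HV)
    as (k & Hk & Hbound).
  rewrite HLa, HLe in Hbound.
  exists Lam, (M_of Lam rm rp rc), a, e, rc.
  repeat split; try assumption.
  - apply M_of_pos; lra.
  (* [rp < rc], since [k * (rc - rp)] is positive by [Hbound]. *)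
  - apply vieta_subextremal; try assumption; nra.
Qed.

Lemma graph_degenerate (rm rp A E : R) :
  0 < rm -> rm < rp -> 0 <= E -> E < gamma_max (rp / rm) ->
  A = l (rp / rm) E ->
  0 < A /\ 0 < Lambda_of rm rp A E /\
  forall a e : R,
    let Lam := Lambda_of rm rp A E in
    let rc := rc_of Lam a e rm rp in
    let M := M_of Lam rm rp rc in
    0 < a -> Lam * a ^ 2 = A -> Lam * e ^ 2 = E ->
    KNdS Lam M a /\
    value_formulas Lam M a e rm rp rc /\
    (forall r : R,
       Delta_r Lam M a e r =
       - (Lam / 3) * (r + (rm + rp + rc)) * (r - rm) * (r - rp) * (r - rc)) /\
    rp = rc.
Proof.
  intros Hm Hmp HE HEmax HAl.
  assert (Halpha : 0 < rp / rm) by (apply Rdiv_lt_0_compat; lra).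
  assert (HA3 : A < 3) by (rewrite HAl; apply l_lt_3; assumption).
  assert (HA : 0 < A).
  { rewrite HAl; apply lt_l_iff; try lra.
    rewrite charge_bound_0; assumption. }
  assert (HEb : charge_bound (rp / rm) A = E)
    by (rewrite HAl; apply charge_bound_l; assumption).
  assert (HL : 0 < Lambda_of rm rp A E) by (apply Lambda_of_pos; lra).
  split; [exact HA | split; [exact HL |]].
  intros a e Lam rc M Ha HLa HLe.
  destruct (formulas_vieta rm rp A E a e Hm Hmp HA HA3 HE
              ltac:(lra) HLa HLe) as (Hc & HqC & HV).
  fold Lam rc M in Hc, HqC, HV, HL.
  destruct (charge_bound_sub_eq _ _ _ _ _ _ _ HL Hm Hmp Hc HqC HV)
    as (k & Hk & Hbound).
  rewrite HLa, HLe in Hbound.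
  (* On the graph the left side of [Hbound] vanishes while [k > 0]. *)
  assert (Hrc : rp = rc) by nra.
  split; [| split; [| split]].
  - repeat split; [exact HL | apply M_of_pos; lra | exact Ha].
  - apply vieta_formulas; try assumption; lra.
  - intros r; apply vieta_factorization, HV.
  - exact Hrc.
Qed.

Theorem lemmaB1 :
  (* every subextremal solution yields an admissible quadruple, and the
     formulas for its parameters hold *)
  (forall Lam M a e rm rp rc : R,
     KNdS Lam M a -> subextremal_radii Lam M a e rm rp rc ->
     admissible rm rp (Lam * a ^ 2) (Lam * e ^ 2) /\
     value_formulas Lam M a e rm rp rc)
  /\
  (* the quadruple determines the solution; the charge enters through e ^ 2 *)
  (forall Lam1 M1 a1 e1 rc1 Lam2 M2 a2 e2 rc2 rm rp : R,
     KNdS Lam1 M1 a1 -> subextremal_radii Lam1 M1 a1 e1 rm rp rc1 ->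
     KNdS Lam2 M2 a2 -> subextremal_radii Lam2 M2 a2 e2 rm rp rc2 ->
     Lam1 * a1 ^ 2 = Lam2 * a2 ^ 2 -> Lam1 * e1 ^ 2 = Lam2 * e2 ^ 2 ->
     Lam1 = Lam2 /\ M1 = M2 /\ a1 = a2 /\ e1 ^ 2 = e2 ^ 2)
  /\
  (* every admissible quadruple arises from a subextremal solution *)
  (forall rm rp A E : R,
     admissible rm rp A E ->
     exists Lam M a e rc : R,
       KNdS Lam M a /\ subextremal_radii Lam M a e rm rp rc /\
       Lam * a ^ 2 = A /\ Lam * e ^ 2 = E)
  /\
  (* on the graph of l the parameters given by the formulas are those of a
     solution whose event and cosmological radii coincide *)
  (forall rm rp A E : R,
     0 < rm -> rm < rp -> 0 <= E -> E < gamma_max (rp / rm) ->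
     A = l (rp / rm) E ->
     0 < A /\ 0 < Lambda_of rm rp A E /\
     forall a e : R,
       let Lam := Lambda_of rm rp A E in
       let rc := rc_of Lam a e rm rp in
       let M := M_of Lam rm rp rc in
       0 < a -> Lam * a ^ 2 = A -> Lam * e ^ 2 = E ->
       KNdS Lam M a /\
       value_formulas Lam M a e rm rp rc /\
       (forall r : R,
          Delta_r Lam M a e r =
          - (Lam / 3) * (r + (rm + rp + rc)) * (r - rm) * (r - rp) * (r - rc)) /\
       rp = rc).
Proof.
  split; [exact subextremal_admissible |].
  split; [exact subextremal_unique |].
  split; [exact admissible_subextremal | exact graph_degenerate].
Qed.
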